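(* For $N\ge1$ let $\mathcal{V}_d^N=\left\{\sum_{i=1}^N r_i\delta_{(x_i,T_i)} : r_i\in\mathbb{R}_+,\ x_i\in\mathbb{R}^n,\ T_i\in\widetilde{G}^n_d\right\}$ be the (non-convex) cone of discrete varifolds with at most $N$ Diracs. For any oriented varifold $\mu\in\mathcal{V}_d$ with $|\mu|(\mathbb{R}^n)<\infty$, there exists a sequence $\mu_N\in\mathcal{V}_d^N$ such that $\lim_{N\to\infty}d_{BL}(\mu_N,\mu)=0$. Moreover, if $\mu$ has compact support, then we can assume that for all $N$, $\mathrm{supp}(\mu_N)\subset K$ for some compact set $K\subset\mathbb{R}^n\times\widetilde{G}^n_d$ and $$d_{BL}(\mu_N,\mu)<\frac{C}{N^{1/(n+d(n-d))}},$$ where $C$ is a constant that only depends on $n$, $d$ and $\mathrm{supp}(\mu)$.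
   Context: Let $0\le d\le n$. $\widetilde{G}^n_d$ is the (compact) manifold of oriented $d$-dimensional linear subspaces of $\mathbb{R}^n$, identified with a subset of the unit sphere of $\Lambda^d(\mathbb{R}^n)$ by $T\mapsto \frac{u_1\wedge\cdots\wedge u_d}{|u_1\wedge\cdots\wedge u_d|}$ for any basis $(u_i)$ of $T$ consistent with its orientation (inner product $\langle \xi_1\wedge\cdots\wedge\xi_d,\eta_1\wedge\cdots\wedge\eta_d\rangle=\det(\xi_i\cdot\eta_j)_{i,j}$). $\mathbb{R}^n\times\widetilde{G}^n_d$ is viewed as a subset of $\mathbb{R}^n\times\Lambda^d(\mathbb{R}^n)$ with the induced metric. $\mathcal{V}_d$ is the set of oriented $d$-varifolds, i.e. nonnegative finite Radon measures on $\mathbb{R}^n\times\widetilde{G}^n_d$; $|\mu|(A)=\mu(A\times\widetilde{G}^n_d)$ for Borel $A\subset\mathbb{R}^n$; $(\mu|\omega)=\int\omega\,d\mu$; $\delta_{(x,T)}$ is the Dirac mass at $(x,T)$. The bounded Lipschitz distance is $d_{BL}(\mu,\nu)=\sup\{|(\mu-\nu|\omega)| : \omega:\mathbb{R}^n\times\widetilde{G}^n_d\to\mathbb{R},\ \|\omega\|_\infty\le1,\ \mathrm{Lip}(\omega)\le1\}$.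
   Formalization: The constant C is allowed to depend also on the total mass |μ|(R^n), besides n, d and supp(μ); with supp(μ) alone the bound fails, since scaling μ = λ(δ_a+δ_b) with N = 1 scales the best distance by λ. *)

(* Defs.v *)
From HB Require Import structures.
From mathcomp Require Import all_boot all_order all_algebra.
From mathcomp Require Import all_classical all_reals all_analysis.

Set Implicit Arguments.
Unset Strict Implicit.
Unset Printing Implicit Defensive.

Import Order.TTheory GRing.Theory Num.Theory.
Import numFieldNormedType.Exports.

Local Open Scope classical_set_scope.
Local Open Scope ring_scope.

(* The library norm of 'rV[R]_m is the sup norm, whence this explicit Euclidean
   norm; the topology is the same. *)
Definition enorm (R : realType) (m : nat) (v : 'rV[R]_m) : R :=
  Num.sqrt (\sum_i v ord0 i ^+ 2).

Definition increasing (n d : nat) : {set d.-tuple 'I_n} :=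
  [set t : d.-tuple 'I_n | sorted ltn [seq val i | i <- t]]%SET.

(* The d-th exterior power of R^n, in the coordinates of the basis of the
   e_I = e_(i_1) /\ ... /\ e_(i_d) with i_1 < ... < i_d.  Since
   det (e_(i_k) . e_(j_l))_(k, l) is 1 if I = J and 0 otherwise, its inner
   product is the standard one in these coordinates, and [enorm] its norm. *)
Definition extpow (R : realType) (n d : nat) := 'rV[R]_#|increasing n d|.

(* u_1 /\ ... /\ u_d, where u_i is the i-th row of U: its coordinates are the
   maximal minors of U. *)
Definition wedge (R : realType) (n d : nat) (U : 'M[R]_(d, n)) : extpow R n d :=
  \row_k \det (colsub (tnth (enum_val k)) U).

(* Oriented d-dimensional subspaces of R^n, as unit vectors of [extpow R n d].
   The sign (-1) ^+ b is redundant if 0 < d (replace u_1 by - u_1); if d = 0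
   it gives both orientations of the zero subspace, whose only basis is empty. *)
Definition orgrass (R : realType) (n d : nat) : set (extpow R n d) :=
  [set T | exists (b : bool) (U : 'M[R]_(d, n)),
     row_free U /\ T = (-1) ^+ b *: ((enorm (wedge U))^-1 *: wedge U)].
Arguments orgrass : clear implicits.

Definition ambient (R : realType) (n d : nat) : Type :=
  ('rV[R]_n * 'rV[R]_#|increasing n d|)%type.

(* R^n x orgrass R n d, a closed subset of the ambient space *)
Definition orpts (R : realType) (n d : nat) : set (ambient R n d) :=
  [set: 'rV[R]_n] `*` orgrass R n d.
Arguments orpts : clear implicits.

Definition edist (R : realType) (n d : nat) (p q : ambient R n d) : R :=
  Num.sqrt (enorm (p.1 - q.1) ^+ 2 + enorm (p.2 - q.2) ^+ 2).

Definition borel (R : realType) (n d : nat) :=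
  g_sigma_algebraType (@open (ambient R n d)).

(* A finite Borel measure on R^n x orgrass is encoded as a finite Borel measure
   on the ambient space that vanishes off R^n x orgrass.  Finite Borel measures
   on this Polish space are automatically Radon. *)
Record varifold (R : realType) (n d : nat) := Varifold {
  varifold_measure :> {finite_measure set (borel R n d) -> \bar R} ;
  varifold_off : varifold_measure (~` orpts R n d) = 0%E }.

(* The measure |mu| on R^n. *)
Definition weight (R : realType) (n d : nat) (mu : varifold R n d)
    (A : set 'rV[R]_n) : \bar R :=
  mu (A `*` orgrass R n d).

(* (mu | w); the values of w outside R^n x orgrass are irrelevant. *)
Definition pairing (R : realType) (n d : nat) (mu : varifold R n d)
    (w : ambient R n d -> R) : \bar R :=
  (\int[mu]_(p in (orpts R n d : set (borel R n d))) (w p)%:E)%E.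

Definition test_function (R : realType) (n d : nat) (w : ambient R n d -> R) :=
  (forall p, orpts R n d p -> `|w p| <= 1) /\
  (forall p q, orpts R n d p -> orpts R n d q -> `|w p - w q| <= edist p q).

Definition dBL (R : realType) (n d : nat) (mu nu : varifold R n d) : \bar R :=
  ereal_sup [set `|pairing mu w - pairing nu w|%E | w in @test_function R n d].

Definition discrete_varifold (R : realType) (n d N : nat)
    (mu : varifold R n d) : Prop :=
  exists (r : 'I_N -> R) (p : 'I_N -> ambient R n d),
    [/\ forall i, 0 <= r i,
        forall i, orpts R n d (p i) &
        forall A : set (borel R n d), measurable A ->
          mu A = (\sum_(i < N) (r i)%:E * \d_(p i : borel R n d) A)%E].

Definition vsupport (R : realType) (n d : nat) (mu : varifold R n d) :
    set (ambient R n d) :=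
  [set p | forall U : set (ambient R n d),
     open U -> U p -> (0 < mu U)%E].

(* Main.v *)
Require Import Defs.
From HB Require Import structures.
From mathcomp Require Import all_boot all_order all_algebra.
From mathcomp Require Import all_classical all_reals all_analysis.
From mathcomp Require Import perm measurable_realfun ring lra.

Set Implicit Arguments.
Unset Strict Implicit.
Unset Printing Implicit Defensive.

Import Order.TTheory GRing.Theory Num.Theory.
Import numFieldNormedType.Exports.

Local Open Scope classical_set_scope.
Local Open Scope ring_scope.

(* Every d-dimensional subspace has a basis matrix W, obtained from any basis
   matrix U by inverting its largest d x d block, whose columns indexed by some
   d-tuple t form the identity and whose other d(n-d) entries have absolute
   value at most 1.  Since |wedge W| >= 1, the oriented Grassmannian is a finite
   union of Lipschitz images of cubes of dimension d(n-d).
   Hence a bounded part of R^n x orgrass has a net of O(k^(n+d(n-d))) points at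
   scale O(1/k); moving the mass of mu to such a net changes the integral of a
   1-Lipschitz function by at most the scale times the mass moved, and what is
   left outside the bounded part is negligible. *)

(* [edist] alone would denote the extended distance of mathcomp-analysis. *)
Local Notation dist := Defs.edist.

(** * Maximal minors and charts of the Grassmannian *)

(** The atoms must stay in one compact set, so the net is chosen inside the support itself, apart
    from one padding point [p0]; the price is that the complement of the support has to be shown
    null. Write D for n + d(n-d). An arbitrary N is rarely the size of a net, so [k] is the largest
    integer with [net_card n d * k ^ D <= N]. The reverse inequality for k + 1 turns an error O(1/k)
    into O(N^(-1/D)). As long as k = 0 the zero varifold serves, at distance at most the total mass.
    Without compact support, the ball of radius j + 1 is treated with k = (j + 1)^2, which leaves
    the scale O(1/(j + 1)), and j is let grow with N. The transport cost is linear in the mass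
    moved, whence the total mass as a factor of the constant. *)

Lemma enorm_ge0 (R : realType) m (v : 'rV[R]_m) : 0 <= enorm v.
Proof. exact: sqrtr_ge0. Qed.

Lemma sum_sqr_ge0 (R : realType) m (v : 'rV[R]_m) :
  0 <= \sum_i v ord0 i ^+ 2.
Proof. by apply: sumr_ge0 => i _; exact: sqr_ge0. Qed.

Lemma enormZ (R : realType) m a (v : 'rV[R]_m) : enorm (a *: v) = `|a| * enorm v.
Proof.
rewrite /enorm -[in RHS]sqrtr_sqr -sqrtrM ?sqr_ge0//; congr Num.sqrt.
by rewrite mulr_sumr; apply: eq_bigr => i _; rewrite mxE exprMn.
Qed.

Lemma coord_le_enorm (R : realType) m (v : 'rV[R]_m) i : `|v ord0 i| <= enorm v.
Proof.
rewrite -sqrtr_sqr ler_sqrt ?sum_sqr_ge0// (bigD1 i)//= lerDl.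
by apply: sumr_ge0 => j _; exact: sqr_ge0.
Qed.

Lemma enorm_eq0 (R : realType) m (v : 'rV[R]_m) : (enorm v == 0) = (v == 0).
Proof.
apply/eqP/eqP => [v0|->]; last first.
  by rewrite -[0 : 'rV[R]_m](scale0r 0) enormZ normr0 mul0r.
by apply/rowP => i; apply/eqP; rewrite mxE -normr_le0 -v0 coord_le_enorm.
Qed.

Lemma det_colsub_mul (R : realType) n d (t : d.-tuple 'I_n) (A : 'M[R]_d)
  (U : 'M[R]_(d, n)) :
  \det (colsub (tnth t) (A *m U)) = \det A * \det (colsub (tnth t) U).
Proof. by rewrite -mulmx_colsub det_mulmx. Qed.

Lemma wedge_mulmx (R : realType) n d (A : 'M[R]_d) (U : 'M[R]_(d, n)) :
  wedge (A *m U) = \det A *: wedge U.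
Proof. by apply/rowP => k; rewrite !mxE det_colsub_mul. Qed.

Lemma colsub_unit_row_free (R : realType) n d (f : 'I_d -> 'I_n)
  (U : 'M[R]_(d, n)) : colsub f U \in unitmx -> row_free U.
Proof.
move=> /mxrank_unit rU; rewrite /row_free eqn_leq rank_leq_row -{1}rU.
by rewrite -[U in colsub f U]mulmx1 -mulmx_colsub mxrankM_maxl.
Qed.

Lemma wedge_neq0_row_free (R : realType) n d (U : 'M[R]_(d, n)) :
  wedge U != 0 -> row_free U.
Proof.
case/rV0Pn => k; rewrite mxE => nz.
by apply: (@colsub_unit_row_free _ _ _ (tnth (enum_val k))); rewrite unitmxE unitfE.
Qed.

Lemma row_free_minor (R : realType) n d (U : 'M[R]_(d, n)) :
  row_free U -> exists t : d.-tuple 'I_n, \det (colsub (tnth t) U) != 0.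
Proof.
move=> rU.
(* [fullrankfun] selects independent rows; after transposition they are columns of [U]. *)
have fU : row_full U^T by rewrite /row_full mxrank_tr.
exists [tuple fullrankfun fU i | i < d].
have := fullrowsub_unit fU; rewrite unitmxE unitfE -det_tr; congr (_ != 0).
by congr (\det _); apply/matrixP => i j; rewrite !mxE tnth_mktuple.
Qed.

(* Sorting t only changes the sign of the minor. *)
Lemma wedge_ge_minor (R : realType) n d (U : 'M[R]_(d, n)) (t : d.-tuple 'I_n) :
  injective (tnth t) -> `|\det (colsub (tnth t) U)| <= enorm (wedge U).
Proof.
move=> tinj.
pose le_ord := relpre (val : 'I_n -> nat) leq.
pose s := sort le_ord t.
have sz : size s == d by rewrite size_sort size_tuple.
have ps : perm_eq s t by rewrite perm_sort.
have /perm.tuple_permP[p sE] := ps.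
pose s' := [tuple tnth t (p i) | i < d].
have us : uniq s.
  by rewrite (perm_uniq ps) -[tval t]/(val t); apply/tuple_uniqP.
have inc : s' \in increasing n d.
  rewrite inE -sE ltn_sorted_uniq_leq (map_inj_uniq (@ord_inj n)).
  rewrite us/= sorted_map; apply: sort_sorted => a b; exact: leq_total.
have := coord_le_enorm (wedge U) (enum_rank_in inc s').
rewrite mxE enum_rankK_in// => H; apply: le_trans H.
have -> : colsub (tnth s') U = col_perm p (colsub (tnth t) U).
  by apply/matrixP => i j; rewrite !mxE tnth_mktuple.
by rewrite col_permE det_mulmx det_perm normrM normrX normrN1 expr1n mulr1 lexx.
Qed.

(** The last clause keeps [wedge W] away from 0, where [normalized] fails to be Lipschitz. *)
Definition unitchart (R : realType) n d (t : d.-tuple 'I_n) (W : 'M[R]_(d, n)) :=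
  [/\ forall i j, `|W i j| <= 1, colsub (tnth t) W = 1%:M & 1 <= enorm (wedge W)].

Lemma colsub1_inj (R : realType) n d (t : d.-tuple 'I_n) (W : 'M[R]_(d, n)) :
  colsub (tnth t) W = 1%:M -> injective (tnth t).
Proof.
move=> W1 i j tij; apply/eqP; apply: contraT => nij.
have := congr1 (fun M : 'M[R]_d => M i i) W1.
have := congr1 (fun M : 'M[R]_d => M i j) W1.
rewrite !mxE tij eqxx (negbTE nij) => -> /eqP.
by rewrite eq_sym oner_eq0.
Qed.

(* Cramer's rule: an entry of W is again a maximal minor of W, and the minor of
   the columns t is the largest one. *)
Lemma chart_exists (R : realType) n d (U : 'M[R]_(d, n)) : row_free U ->
  exists (t : d.-tuple 'I_n) (W : 'M[R]_(d, n)) (a : R),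
    [/\ unitchart t W, a != 0 & wedge W = a *: wedge U].
Proof.
move=> /row_free_minor[t0 nz0].
pose m (t : d.-tuple 'I_n) := `|\det (colsub (tnth t) U)|.
(* The maximum runs over all d-tuples, not just the increasing ones, so that it also dominates the
   tuple [s] used below. *)
pose t := [arg max_(t > t0) m t]%O.
have tmax s : m s <= m t by rewrite /t; case: arg_maxP => // i _; apply.
have nz : \det (colsub (tnth t) U) != 0.
  by rewrite -normr_gt0; apply: lt_le_trans (tmax t0); rewrite normr_gt0.
pose W := invmx (colsub (tnth t) U) *m U.
have uU : colsub (tnth t) U \in unitmx by rewrite unitmxE unitfE.
have W1 : colsub (tnth t) W = 1%:M by rewrite -mulmx_colsub mulVmx.
have Wle s : `|\det (colsub (tnth s) W)| <= 1.
  rewrite det_colsub_mul det_inv normrM normfV mulrC ler_pdivrMr ?normr_gt0//.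
  by rewrite mul1r; exact: tmax.
exists t, W, (\det (colsub (tnth t) U))^-1; split; last 2 first.
- by rewrite invr_eq0.
- by rewrite wedge_mulmx det_inv.
split=> //; last first.
  have := wedge_ge_minor W (colsub1_inj W1).
  by rewrite W1 det1 normr1.
move=> i j.
(* The columns of [W] selected by [s] are those of the identity, except that the i-th is column [j]
   of [W]. Expanding along row [i] leaves [W i j] times an identity minor. *)
pose s := [tuple if k == i then j else tnth t k | k < d].
suff <- : \det (colsub (tnth s) W) = W i j by [].
rewrite (expand_det_row _ i) (bigD1 i)//= big1 => [|k nki]; last first.
  rewrite mxE tnth_mktuple (negbTE nki).
  have := congr1 (fun M : 'M[R]_d => M i k) W1.
  by rewrite !mxE eq_sym (negbTE nki) => ->; rewrite mul0r.
rewrite addr0 mxE tnth_mktuple eqxx /cofactor.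
have -> : row' i (col' i (colsub (tnth s) W)) = 1%:M.
  apply/matrixP => a b; rewrite !mxE tnth_mktuple eq_sym (negbTE (neq_lift i b)).
  have := congr1 (fun M : 'M[R]_d => M (lift i a) (lift i b)) W1.
  by rewrite !mxE => ->; rewrite (inj_eq (@lift_inj _ i)).
by rewrite det1 mulr1 -signr_odd oddD addbb expr0 mulr1.
Qed.

Definition normalized (R : realType) m (v : 'rV[R]_m) := (enorm v)^-1 *: v.

(** A change of basis multiplies the wedge by a determinant, of which only the sign, that is the
    orientation, survives normalization. *)
Lemma normalizedZ (R : realType) m (a : R) (v : 'rV[R]_m) : a != 0 ->
  normalized (a *: v) = (-1) ^+ (a < 0)%R *: normalized v.
Proof.
move=> a0; rewrite /normalized enormZ invfM scalerA -mulrA [_^-1 * a]mulrC mulrA.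
rewrite scalerA; congr (_ * _ *: _).
by rewrite [a in _ * a]numEsign mulrC -mulrA divff ?mulr1// normr_eq0.
Qed.

Lemma orgrass_chartP (R : realType) n d (T : extpow R n d) :
  orgrass R n d T <->
  exists (b : bool) (t : d.-tuple 'I_n) (W : 'M[R]_(d, n)),
    unitchart t W /\ T = (-1) ^+ b *: normalized (wedge W).
Proof.
split=> [[b [U [rU ->]]]|[b [t [W [[_ W1 W2] ->]]]]]; last first.
  exists b, W; split => //; apply: wedge_neq0_row_free.
  by rewrite -enorm_eq0 gt_eqF// (lt_le_trans _ W2).
have [t [W [a [ch a0 WE]]]] := chart_exists rU.
exists (b (+) (a < 0)%R), t, W; split => //.
rewrite WE normalizedZ// scalerA signr_addb -mulrA -signr_addb addbb mulr1.
by [].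
Qed.

Lemma orpts_nonempty (R : realType) n d : (d <= n)%N ->
  exists p : ambient R n d, orpts R n d p.
Proof.
move=> dn; exists (0, normalized (wedge (pid_mx d))); split => //=.
exists false, (pid_mx d); rewrite expr0 scale1r; split => //.
by rewrite /row_free rank_pid_mx.
Qed.

(** * Lipschitz estimates *)

(** Replace the factors one at a time: each replacement costs at most [e], as all other factors have
    absolute value at most 1. *)
Lemma prod_dist (R : realType) (I : Type) (s : seq I) (a b : I -> R) (e : R) :
  (forall i, `|a i| <= 1) -> (forall i, `|b i| <= 1) ->
  (forall i, `|a i - b i| <= e) ->
  `|\prod_(i <- s) a i - \prod_(i <- s) b i| <= (size s)%:R * e.
Proof.
move=> a1 b1 ab.
have b1s (r : seq I) : `|\prod_(i <- r) b i| <= 1.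
  elim: r => [|i r IH]; first by rewrite big_nil normr1.
  by rewrite big_cons normrM mulr_ile1.
elim: s => [|i s IH]; first by rewrite !big_nil subrr normr0 mul0r.
rewrite !big_cons /= -natr1 mulrDl mul1r.
have -> : a i * \prod_(j <- s) a j - b i * \prod_(j <- s) b j =
  a i * (\prod_(j <- s) a j - \prod_(j <- s) b j) +
  (a i - b i) * \prod_(j <- s) b j by ring.
apply: le_trans (ler_normD _ _) _; rewrite !normrM lerD//.
  by apply: le_trans IH; rewrite ler_piMl.
by apply: le_trans (ab i); rewrite ler_piMr.
Qed.

(** Leibniz formula: d! products of d factors each, every product handled by [prod_dist]. *)
Lemma det_dist (R : realType) d (A B : 'M[R]_d) (e : R) :
  (forall i j, `|A i j| <= 1) -> (forall i j, `|B i j| <= 1) ->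
  (forall i j, `|A i j - B i j| <= e) ->
  `|\det A - \det B| <= (d`! * d)%:R * e.
Proof.
move=> A1 B1 AB; rewrite -sumrB (le_trans (ler_norm_sum _ _ _))//.
rewrite natrM -mulrA -card_Sn -sum1_card natr_sum mulr_suml ler_sum// => s _.
rewrite mul1r -mulrBr normrM normrX normrN1 expr1n mul1r.
have := @prod_dist R 'I_d (index_enum _) (fun i => A i (s i)) (fun i => B i (s i)) e.
rewrite /index_enum -enumT size_enum_ord; apply=> //.
Qed.

Lemma wedge_dist (R : realType) n d (U V : 'M[R]_(d, n)) (e : R) k :
  (forall i j, `|U i j| <= 1) -> (forall i j, `|V i j| <= 1) ->
  (forall i j, `|U i j - V i j| <= e) ->
  `|wedge U ord0 k - wedge V ord0 k| <= (d`! * d)%:R * e.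
Proof.
by move=> U1 V1 UV; rewrite !mxE; apply: det_dist => i j; rewrite !mxE.
Qed.

Lemma enorm_le_sum (R : realType) m (v : 'rV[R]_m) :
  enorm v <= \sum_i `|v ord0 i|.
Proof.
have s0 : 0 <= \sum_i `|v ord0 i| by apply: sumr_ge0.
rewrite -[leRHS]ger0_norm// -sqrtr_sqr ler_sqrt ?sqr_ge0//.
rewrite expr2 mulr_sumr ler_sum// => i _.
rewrite -real_normK ?num_real// expr2.
by rewrite ler_wpM2r// (bigD1 i)//= lerDl sumr_ge0.
Qed.

Lemma sqr_enorm (R : realType) m (v : 'rV[R]_m) :
  enorm v ^+ 2 = \sum_i v ord0 i ^+ 2.
Proof. by rewrite sqr_sqrtr// sum_sqr_ge0. Qed.

(* |x| - |y| = (|x|^2 - |y|^2) / (|x| + |y|), and |x_i + y_i| <= |x| + |y|. *)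
Lemma enorm_dist (R : realType) m (x y : 'rV[R]_m) :
  `|enorm x - enorm y| <= \sum_i `|x ord0 i - y ord0 i|.
Proof.
have [s0|] := ltP 0 (enorm x + enorm y); last first.
  move=> s0; have := enorm_ge0 x; have := enorm_ge0 y => y0 x0.
  have -> : enorm x - enorm y = 0 by lra.
  by rewrite normr0 sumr_ge0.
rewrite -(ler_pM2r s0) -{1}(gtr0_norm s0) -normrM -subr_sqr !sqr_enorm -sumrB.
apply: le_trans (ler_norm_sum _ _ _) _; rewrite mulr_suml ler_sum// => i _.
rewrite subr_sqr normrM ler_wpM2l// (le_trans (ler_normD _ _))//.
by rewrite lerD// coord_le_enorm.
Qed.

Lemma normalized_dist (R : realType) m (x y : 'rV[R]_m) i :
  1 <= enorm x -> 1 <= enorm y ->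
  `|normalized x ord0 i - normalized y ord0 i| <=
  2 * \sum_j `|x ord0 j - y ord0 j|.
Proof.
move=> x1 y1; rewrite !mxE.
have x0 : 0 < enorm x by exact: lt_le_trans x1.
have y0 : 0 < enorm y by exact: lt_le_trans y1.
(* The first term changes the vector, the second the norm. Dividing by norms that are at least 1
   costs nothing, and each term contributes one unit of the factor 2. *)
have -> : (enorm x)^-1 * x ord0 i - (enorm y)^-1 * y ord0 i =
  (x ord0 i - y ord0 i) / enorm x +
  (enorm x)^-1 * (y ord0 i / enorm y * (enorm y - enorm x)).
  by field; rewrite !gt_eqF.
have ix : (enorm x)^-1 <= 1 by rewrite invf_le1.
have ix0 : 0 <= (enorm x)^-1 by rewrite invr_ge0 ltW.
rewrite mulr_natl mulr2n; apply: le_trans (ler_normD _ _) _; apply: lerD.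
  rewrite normrM (ger0_norm ix0) (@le_trans _ _ `|x ord0 i - y ord0 i|)//.
    by rewrite ler_piMr.
  by rewrite (bigD1 i)//= lerDl sumr_ge0.
rewrite 2!normrM (ger0_norm ix0) (@le_trans _ _ `|enorm y - enorm x|)//.
  rewrite mulrA ler_piMl// mulr_ile1//.
  by rewrite normrM normfV (gtr0_norm y0) ler_pdivrMr// mul1r coord_le_enorm.
by rewrite distrC enorm_dist.
Qed.

(** The 2 comes from [normalized_dist], which sums over the [#|increasing n d|] coordinates of the
    wedge; [det_dist] bounds each of them. *)
Definition chart_lip n d : nat := 2 * (#|increasing n d| * (d`! * d)).

Lemma chart_dist (R : realType) n d (t t' : d.-tuple 'I_n)
  (U V : 'M[R]_(d, n)) (e : R) k :
  unitchart t U -> unitchart t' V -> (forall i j, `|U i j - V i j| <= e) ->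
  `|normalized (wedge U) ord0 k - normalized (wedge V) ord0 k| <=
  (chart_lip n d)%:R * e.
Proof.
move=> [U1 _ nU] [V1 _ nV] UV.
apply: le_trans (normalized_dist k nU nV) _.
rewrite /chart_lip natrM -mulrA ler_wpM2l//.
rewrite natrM -mulrA mulr_natl -[X in _ *+ X]card_ord -sumr_const ler_sum//.
by move=> i _; exact: wedge_dist.
Qed.

Lemma dist_le_sum (R : realType) n d (p q : ambient R n d) :
  dist p q <= \sum_i `|p.1 ord0 i - q.1 ord0 i| +
               \sum_i `|p.2 ord0 i - q.2 ord0 i|.
Proof.
apply: (@le_trans _ _ (enorm (p.1 - q.1) + enorm (p.2 - q.2))).
  rewrite -[leRHS]ger0_norm ?addr_ge0 ?enorm_ge0// -sqrtr_sqr.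
  rewrite ler_sqrt ?sqr_ge0// sqrrD -addrA lerD2l lerDr.
  by rewrite mulrn_wge0// mulr_ge0 ?enorm_ge0.
apply: lerD; apply: le_trans (enorm_le_sum _) _; apply: ler_sum => i _;
  by rewrite !mxE.
Qed.

Lemma dist_ge_coord1 (R : realType) n d (p q : ambient R n d) i :
  `|p.1 ord0 i - q.1 ord0 i| <= dist p q.
Proof.
have := coord_le_enorm (p.1 - q.1) i; rewrite !mxE => /le_trans; apply.
rewrite -[leLHS]ger0_norm ?enorm_ge0// -sqrtr_sqr ler_sqrt ?lerDl ?sqr_ge0//.
by rewrite addr_ge0// sqr_ge0.
Qed.

Lemma dist_ge_coord2 (R : realType) n d (p q : ambient R n d) i :
  `|p.2 ord0 i - q.2 ord0 i| <= dist p q.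
Proof.
have := coord_le_enorm (p.2 - q.2) i; rewrite !mxE => /le_trans; apply.
rewrite -[leLHS]ger0_norm ?enorm_ge0// -sqrtr_sqr ler_sqrt ?lerDr ?sqr_ge0//.
by rewrite addr_ge0// sqr_ge0.
Qed.

Lemma dist_sym (R : realType) n d (p q : ambient R n d) : dist p q = dist q p.
Proof.
rewrite /Defs.edist -opprB -scaleN1r enormZ -[p.2 - _]opprB.
by rewrite -[- (_ - p.2)]scaleN1r enormZ normrN1 !mul1r.
Qed.

Lemma dist_ge0 (R : realType) n d (p q : ambient R n d) : 0 <= dist p q.
Proof. exact: sqrtr_ge0. Qed.

Lemma distxx (R : realType) n d (p : ambient R n d) : dist p p = 0.
Proof.
by apply/eqP; rewrite eq_le dist_ge0 andbT (le_trans (dist_le_sum _ _))//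
  !big1 ?addr0// => i _; rewrite subrr normr0.
Qed.

(* k + 1 cells, of width 2 r / k, cover [-r, r]. *)
Definition cell (R : realType) (k : nat) (r a : R) : 'I_k.+1 :=
  inord (Num.truncn ((a + r) * k%:R / (2 * r))).

Lemma cell_dist (R : realType) k (r a b : R) : (0 < k)%N -> 0 < r ->
  `|a| <= r -> `|b| <= r -> cell k r a = cell k r b -> `|a - b| <= 2 * r / k%:R.
Proof.
move=> k0 r0.
have kR : 0 < k%:R :> R by rewrite ltr0n.
suff cellP c : `|c| <= r ->
    (cell k r c)%:R <= (c + r) * k%:R / (2 * r) < (cell k r c)%:R + 1.
  move=> /cellP/andP[a1 a2] /cellP/andP[b1 b2] ab.
  rewrite ab in a1 a2.
  have E : a - b = ((a + r) * k%:R / (2 * r) - (b + r) * k%:R / (2 * r)) *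
      (2 * r / k%:R).
    by field; rewrite !gt_eqF.
  rewrite E normrM [X in _ * X]ger0_norm ?ler_piMl ?divr_ge0 ?mulr_ge0 ?ltW//.
  by rewrite ltr_norml; apply/andP; split; lra.
rewrite ler_norml => /andP[c1 c2].
have ge0 : 0 <= (c + r) * k%:R / (2 * r).
  by apply: mulr_ge0; [apply: mulr_ge0; [lra|exact: ltW]|rewrite invr_ge0; lra].
(* The endpoint c = r has index exactly [k], which still fits, so [inord] never returns its
   default. *)
have lek : (c + r) * k%:R / (2 * r) <= k%:R.
  by rewrite ler_pdivrMr ?mulr_gt0// mulrC ler_wpM2l ?ler0n//; lra.
rewrite /cell inordK ?natr1 ?truncn_itv//.
by rewrite ltnS -(ler_nat R) (le_trans _ lek)// truncn_le.
Qed.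

(** * Nets *)

(** One representative in [S] is picked for each code that occurs in [S]. The point [x0] stands in
    for codes that do not occur, and the indices beyond [#|T|] repeat the representative of
    [code x0]. *)
Lemma finite_net (T : finType) (X : choiceType) (S : set X) (code : X -> T)
  (N : nat) (x0 : X) : (#|T| <= N)%N ->
  exists q : 'I_N -> X, (forall i, S (q i) \/ q i = x0) /\
    forall x, S x -> exists i, S (q i) /\ code (q i) = code x.
Proof.
move=> TN; pose rep t := xget x0 [set x | S x /\ code x = t].
exists (fun i : 'I_N => rep (nth (code x0) (enum T) i)); split => [i|x Sx].
  rewrite /rep; case: xgetP => [y yE [Sy _]|_]; [by left|by right].
have iT : (index (code x) (enum T) < #|T|)%N by rewrite cardE index_mem mem_enum.
exists (Ordinal (leq_trans iT TN)) => /=.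
rewrite nth_index ?mem_enum// /rep; case: xgetP => [y yE//|/(_ x)].
by case; split.
Qed.

(* The factor 2 ^ (n + d (n - d)) absorbs (k + 1) ^ _ <= (2 k) ^ _. *)
Definition net_card n d : nat := 2 * n ^ d * 2 ^ (n + d * (n - d)).

(** Sum over the n coordinates of the point and the coordinates of the d-vector, the latter
    magnified by [chart_lip]; the 2 is the cell width 2 r / k. *)
Definition net_lip n d : nat := 2 * (n + #|increasing n d| * chart_lip n d).

Section net.
Context (R : realType) (n d : nat).

(** Only the columns outside [t] are recorded, which gives d(n-d) parameters instead of dn. In a
    chart [t] is injective, so there are exactly n - d such columns and the default [ord0] is never
    read. *)
Definition chart_code (k : nat) (t : d.-tuple 'I_n) (W : 'M[R]_(d, n)) :
    {ffun 'I_d * 'I_(n - d) -> 'I_k.+1} :=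
  [ffun il : 'I_d * 'I_(n - d) =>
     nth ord0 [seq cell k 1 (W il.1 j) | j <- enum [predC t]] (nat_of_ord il.2)].

Definition in_chart (T : extpow R n d) (btW : bool * d.-tuple 'I_n * 'M[R]_(d, n)) :=
  unitchart btW.1.2 btW.2 /\
  T = (-1) ^+ btW.1.1 *: normalized (wedge btW.2).

Lemma chart_code_dist k (t : d.-tuple 'I_n) (U V : 'M[R]_(d, n)) : (0 < k)%N ->
  unitchart t U -> unitchart t V -> chart_code k t U = chart_code k t V ->
  forall i j, `|U i j - V i j| <= 2 / k%:R.
Proof.
move=> k0 [U1 Ut _] [V1 Vt _] UV i j.
have [/tnthP[l ->]|jt] := boolP (j \in t).
  have := congr1 (fun M : 'M[R]_d => M i l) Ut.
  have := congr1 (fun M : 'M[R]_d => M i l) Vt.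
  by rewrite !mxE => -> ->; rewrite subrr normr0 divr_ge0.
have jc : j \in enum [predC t] by rewrite mem_enum inE.
have sz : size (enum [predC t]) = (n - d)%N.
  have ut : uniq t by apply/tuple_uniqP; exact: colsub1_inj Ut.
  have := cardC (mem t); rewrite card_ord (card_uniqP ut) size_tuple => cC.
  by rewrite -cardE -[X in (X - d)%N]cC addKn.
have jl : (index j (enum [predC t]) < n - d)%N by rewrite -sz index_mem.
have := congr1 (fun f : {ffun 'I_d * 'I_(n - d) -> 'I_k.+1} => f (i, Ordinal jl)) UV.
rewrite !ffunE /= !(nth_map j) ?index_mem// nth_index//.
by move=> /(cell_dist k0 ltr01 (U1 i j) (V1 i j)); rewrite mulr1.
Qed.

Lemma orpts_net (S : set (ambient R n d)) (p0 : ambient R n d) (r : R)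
    (k N : nat) :
  S `<=` orpts R n d -> 1 <= r -> (forall p i, S p -> `|p.1 ord0 i| <= r) ->
  (0 < k)%N -> (net_card n d * k ^ (n + d * (n - d)) <= N)%N ->
  exists q : 'I_N -> ambient R n d, (forall i, S (q i) \/ q i = p0) /\
    forall p, S p -> exists i, dist p (q i) <= (net_lip n d)%:R * r / k%:R.
Proof.
move=> Sor r1 Sr k0 kN.
have r0 : 0 < r by exact: lt_le_trans r1.
have [[s Ss]|S0] := pselect (S !=set0); last first.
  by exists (fun=> p0); split=> [i|p Sp]; [right|case: S0; exists p].
have chart p : S p -> exists btW, in_chart p.2 btW.
  by move=> /Sor[_ /orgrass_chartP[b [t [W H]]]]; exists (b, t, W).
(* Off [S] the chart of [s] serves as a dummy, to make the choice total. *)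
have : forall p, exists btW, S p -> in_chart p.2 btW.
  move=> p; have [/chart[btW H]|nSp] := pselect (S p); first by exists btW.
  by have [btW _] := chart _ Ss; exists btW.
move=> /choice[ch chP].
(* Equal codes mean the same orientation and tuple, hence the same chart, with all parameters in the
   same cells. *)
pose code (p : ambient R n d) :=
  ([ffun i => cell k r (p.1 ord0 i)] : {ffun 'I_n -> 'I_k.+1},
  (ch p).1, chart_code k (ch p).1.2 (ch p).2).
have [|q [q0 qP]] := @finite_net _ _ S code N p0.
  apply: leq_trans kN; rewrite !card_prod !card_ffun !card_ord card_bool.
  rewrite card_prod !card_ord card_tuple card_ord /net_card.
  rewrite [(k.+1 ^ n * _)%N]mulnC -mulnA -expnD -[X in (_ <= X)%N]mulnA -expnMn.
  rewrite leq_mul2l; apply/orP; right; case: (n + _)%N => // e.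
  by rewrite leq_exp2r// mul2n -addnn -addn1 leq_add2l.
exists q; split=> // p Sp; have [i [Sq /esym]] := qP p Sp.
rewrite /code => -[xE btE WE]; exists i.
have [pch pE] := chP _ Sp; have [qch qE] := chP _ Sq.
rewrite -btE in qch qE WE.
have Wd := chart_code_dist k0 pch qch WE.
have x_d j : `|p.1 ord0 j - (q i).1 ord0 j| <= 2 * r / k%:R.
  apply: cell_dist => //; [exact: Sr|exact: Sr|].
  by have := congr1 (fun f : {ffun 'I_n -> 'I_k.+1} => f j) xE; rewrite !ffunE.
have T_d j : `|p.2 ord0 j - (q i).2 ord0 j| <= (chart_lip n d)%:R * (2 * r / k%:R).
  have sE b (v : extpow R n d) : ((-1) ^+ (b : bool) *: v) ord0 j = (-1) ^+ b * v ord0 j.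
    by rewrite mxE.
  rewrite pE qE !sE -mulrBr normrM normrX normrN1 expr1n mul1r.
  apply: le_trans (chart_dist j pch qch Wd) _.
  (* Chart entries lie in [-1, 1] and give the scale 2 / k; [1 <= r] brings it to the common scale 2
     r / k. *)
  by rewrite ler_wpM2l// ler_wpM2r ?invr_ge0// ler_peMr.
apply: le_trans (dist_le_sum _ _) _.
apply: (@le_trans _ _ (n%:R * (2 * r / k%:R) +
    #|increasing n d|%:R * ((chart_lip n d)%:R * (2 * r / k%:R)))).
  by apply: lerD; rewrite mulr_natl -[X in _ *+ X]card_ord -sumr_const ler_sum.
by rewrite le_eqVlt /net_lip natrM natrD natrM; apply/orP; left; apply/eqP; ring.
Qed.
End net.

(** * Closedness of the Grassmannian *)

Lemma continuous_mx (T : topologicalType) (R : topologicalType) m n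
    (f : T -> 'M[R]_(m, n)) (x : T) :
  (forall i j, {for x, continuous (fun y => f y i j)}) -> {for x, continuous f}.
Proof.
move=> fc A [P nP sPA].
have : \forall y \near x, forall i j, P i j (f y i j).
  by apply: filter_forall => i; apply: filter_forall => j; exact: fc (nP i j).
by apply: filterS => y Py; exact: sPA.
Qed.

Lemma continuous_sum (R : realType) (T : topologicalType) (I : finType)
    (f : I -> T -> R) :
  (forall i, continuous (f i)) -> continuous (fun x => \sum_i f i x).
Proof. by move=> fc; apply: continuous_big => //; exact: add_continuous. Qed.

Lemma continuous_prod (R : realType) (T : topologicalType) (I : finType)
    (f : I -> T -> R) :
  (forall i, continuous (f i)) -> continuous (fun x => \prod_i f i x).
Proof. by move=> fc; apply: continuous_big => //; exact: mul_continuous. Qed.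

Lemma continuous_sqr (R : realType) (T : topologicalType) (f : T -> R) :
  continuous f -> continuous (fun x => f x ^+ 2).
Proof. by move=> fc x; exact: (continuousM (fc x) (fc x)). Qed.

Lemma continuous_det (R : realType) (T : topologicalType) m (f : T -> 'M[R]_m) :
  (forall i j, continuous (fun x => f x i j)) -> continuous (fun x => \det (f x)).
Proof.
move=> fc; apply: continuous_sum => s x.
apply: (@continuousM _ _ (fun=> (-1) ^+ s) (fun y => \prod_i f y i (s i))).
  exact: cst_continuous.
by apply: continuous_prod => i; exact: fc.
Qed.

Lemma continuous_enorm (R : realType) (T : topologicalType) m (f : T -> 'rV[R]_m) :
  (forall i, continuous (fun x => f x ord0 i)) -> continuous (fun x => enorm (f x)).
Proof.
move=> fc x; apply: (@continuous_comp _ _ _ (fun y => \sum_i f y ord0 i ^+ 2) Num.sqrt).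
  by apply: continuous_sum => i; apply: continuous_sqr.
exact: sqrt_continuous.
Qed.

Lemma compact_setU (T : topologicalType) (A B : set T) :
  compact A -> compact B -> compact (A `|` B).
Proof.
move=> cA cB.
have -> : A `|` B = \big[setU/set0]_(b <- [:: true; false]) (if b then A else B).
  by rewrite !big_cons big_nil setU0.
by apply: bigsetU_compact => -[].
Qed.

(** For each orientation, a continuous image of the compact set [K] of matrices with entries in
    [-1, 1] and wedge of norm at least 1. [K] drops the identity block, since a nonzero wedge
    already forces full row rank. *)
Lemma compact_orgrass (R : realType) n d : compact (orgrass R n d).
Proof.
pose cube := [set v : 'rV[R]_(d * n) | forall i, `[-1, 1]%classic (v ord0 i)].
pose w (v : 'rV[R]_(d * n)) := wedge (vec_mx v).
have wc i : continuous (fun v => w v ord0 i).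
  have -> : (fun v => w v ord0 i) =
      (fun v => \det (colsub (tnth (enum_val i)) (vec_mx v))).
    by apply/funext => v; rewrite mxE.
  apply: continuous_det => j k.
  have -> : (fun v => colsub (tnth (enum_val i)) (vec_mx v) j k) =
      (fun v : 'rV[R]_(d * n) => v ord0 (mxvec_index j (tnth (enum_val i) k))).
    by apply/funext => v; rewrite !mxE.
  exact: coord_continuous.
have nwc : continuous (fun v => enorm (w v)) by exact: continuous_enorm.
pose K := [set v | 1 <= enorm (w v)] `&` cube.
have ccube : compact cube.
  apply: (@rV_compact R _ (fun=> `[-1, 1]%classic)) => i; exact: segment_compact.
have cK : compact K.
  apply: (subclosed_compact _ ccube) => [|v []//].
  apply: closedI; last first.
    by apply: (compact_closed _ ccube); exact: (@norm_hausdorff R 'rV[R]_(d * n)).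
  apply: (@preimage_closed _ _ (fun v => enorm (w v)) [set x | 1 <= x]).
    by move=> v _; exact: nwc.
  exact: closed_ge.
pose f (b : bool) v := (-1) ^+ b *: normalized (w v).
suff cf b : compact (f b @` K).
  have -> : orgrass R n d = f true @` K `|` f false @` K; last exact: compact_setU.
  apply/seteqP; split => [T /orgrass_chartP[b [t [W [[W1 _ W2] ->]]]]|T].
    suff : (f b @` K) ((-1) ^+ b *: normalized (wedge W)).
      by case: b => ?; [left|right].
    exists (mxvec W); last by rewrite /f /w mxvecK.
    split; first by rewrite /= /w mxvecK.
    move=> k; case/mxvec_indexP: k => i j.
    by rewrite mxvecE /= in_itv/= -ler_norml.
  suff fT b : (f b @` K) T -> orgrass R n d T by case; exact: fT.
  move=> [v [v1 _] <-].
  exists b, (vec_mx v); split => //; apply: wedge_neq0_row_free.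
  by rewrite -enorm_eq0 gt_eqF// (lt_le_trans _ v1).
apply: continuous_compact => //.
apply: continuous_in_subspaceT => v; rewrite inE => -[v1 _].
apply: continuous_mx => i j; rewrite ord1.
have -> : (fun v => f b v ord0 j) =
    (fun v => (-1) ^+ b * ((enorm (w v))^-1 * w v ord0 j)).
  by apply/funext => u; rewrite !mxE.
apply: (@continuousM _ _ (fun=> _) (fun v => (enorm (w v))^-1 * w v ord0 j)).
  exact: cst_continuous.
apply: (@continuousM _ _ (fun v => (enorm (w v))^-1) (fun v => w v ord0 j)).
  by apply: continuousV; [rewrite gt_eqF// (lt_le_trans _ v1)|exact: nwc].
exact: wc.
Qed.

Lemma closed_orpts (R : realType) n d : closed (orpts R n d).
Proof.
have -> : orpts R n d = snd @^-1` orgrass R n d.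
  by apply/seteqP; split=> [p []|p].
apply: preimage_closed; first by move=> p _; exact: cvg_snd.
apply: (compact_closed _ (@compact_orgrass R n d)).
exact: (@norm_hausdorff R (extpow R n d)).
Qed.

Lemma continuous_dist (R : realType) n d (p : ambient R n d) :
  continuous (dist p : ambient R n d -> R).
Proof.
have cE (f : ambient R n d -> R) (a : R) :
    continuous f -> continuous (fun q => (a - f q) ^+ 2).
  move=> fc; apply: continuous_sqr => q.
  by apply: (@continuousB _ _ _ (fun=> a) f); [exact: cst_continuous|exact: fc].
have -> : dist p = fun q : ambient R n d =>
    Num.sqrt (\sum_i (p.1 ord0 i - q.1 ord0 i) ^+ 2 +
              \sum_i (p.2 ord0 i - q.2 ord0 i) ^+ 2).
  apply/funext => q; rewrite /Defs.edist !sqr_enorm; congr (Num.sqrt (_ + _)).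
    by apply: eq_bigr => i _; rewrite !mxE.
  by apply: eq_bigr => i _; rewrite !mxE.
move=> q.
apply: (@continuous_comp _ _ _ (fun q : ambient R n d =>
  \sum_i (p.1 ord0 i - q.1 ord0 i) ^+ 2 + \sum_i (p.2 ord0 i - q.2 ord0 i) ^+ 2)
  Num.sqrt); last exact: sqrt_continuous.
apply: (@continuousD _ _ _ (fun q : ambient R n d =>
  \sum_i (p.1 ord0 i - q.1 ord0 i) ^+ 2)
  (fun q : ambient R n d => \sum_i (p.2 ord0 i - q.2 ord0 i) ^+ 2)).
- apply: continuous_sum => i; apply: cE => u.
  apply: (@continuous_comp _ _ _ fst (fun v : 'rV[R]_n => v ord0 i)).
    exact: cvg_fst.
  exact: coord_continuous.
- apply: continuous_sum => i; apply: cE => u.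
  apply: (@continuous_comp _ _ _ snd (fun v : extpow R n d => v ord0 i)).
    exact: cvg_snd.
  exact: coord_continuous.
Qed.

(** Coordinate differences are bounded by [dist], so a [dist] ball lies in the sup-norm ball of the
    same radius. *)
Lemma nbhs_dist (R : realType) n d (p : ambient R n d) (U : set (ambient R n d)) :
  open U -> U p -> exists2 e : R, 0 < e & forall q, dist p q < e -> U q.
Proof.
move=> oU Up; have : nbhs p U by exact: open_nbhs_nbhs.
case/nbhs_ballP => e e0 eU; exists e => // q pq; apply: eU.
by split; split=> // i j; rewrite /ball/= ord1 (le_lt_trans _ pq)//;
  [exact: dist_ge_coord1|exact: dist_ge_coord2].
Qed.

(** * Measures with finitely many atoms *)

Section discrete_measure.
Context d (T : measurableType d) (R : realType).

Lemma sum_dirac_measure N (r : 'I_N -> R) (p : 'I_N -> T) :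
  (forall i, 0 <= r i) ->
  exists nu : {finite_measure set T -> \bar R},
    (forall A, nu A = (\sum_(i < N) (r i)%:E * \d_(p i) A)%E) /\
    forall (D : set T) (f : T -> R), measurable D -> measurable_fun D f ->
      (forall i, D (p i)) ->
      (\int[nu]_(x in D) (f x)%:E = (\sum_(i < N) r i * f (p i))%:E)%E.
Proof.
move=> r0.
pose m_ (k : nat) : {measure set T -> \bar R} :=
  if insub k is Some i then mscale (NngNum (r0 i)) \d_(p i) else mzero.
have m_E (i : 'I_N) : m_ i = mscale (NngNum (r0 i)) \d_(p i) :> measure _ _.
  by rewrite /m_ valK.
have mE A : msum m_ N A = (\sum_(i < N) (r i)%:E * \d_(p i) A)%E.
  by rewrite /msum; apply: eq_bigr => i _; rewrite m_E.
have fin : fin_num_fun (msum m_ N).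
  move=> A mA; rewrite mE.
  by under eq_bigr do rewrite diracE -EFinM; rewrite sumEFin.
pose H := Measure_isFinite.Build _ _ _ (msum m_ N) fin.
pose nu : {finite_measure set T -> \bar R} := HB.pack (msum m_ N) H.
exists nu; split=> [A|D f mD mf Dp]; first exact: mE.
have ge0int (g : T -> \bar R) : (forall x, 0 <= g x)%E -> measurable_fun D g ->
    (\int[nu]_(x in D) g x = \sum_(i < N) (r i)%:E * g (p i))%E.
  move=> g0 mg; rewrite [LHS](ge0_integral_measure_sum m_ mD)//.
  apply: eq_bigr => i _; rewrite m_E ge0_integral_mscale//= integral_dirac//.
  by rewrite diracE mem_set// mul1e.
have mF : measurable_fun D (EFin \o f) by exact/measurable_EFinP.
(* The formula for nonnegative integrands is applied to the positive and negative parts, whose sums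
   are finite. *)
rewrite integralE !ge0int//; [|exact: measurable_funeneg|exact: measurable_funepos].
under eq_bigr do rewrite funeposE -EFin_max -EFinM.
under [X in (_ - X)%E]eq_bigr do rewrite funenegE -EFin_max -EFinM.
rewrite !sumEFin -EFinB -sumrB; congr EFin; apply: eq_bigr => i _.
by rewrite -mulrBr; congr (_ * _); rewrite !maxEle; case: ifP; case: ifP; lra.
Qed.

(** On a cell [f] is within [e] of its value at the chosen point, which gives the first term. What
    the cells miss carries no atom and costs at most its mass, because f is bounded by 1. *)
Lemma integral_step_le (mu : {finite_measure set T -> \bar R}) N (D : set T)
    (A : 'I_N -> set T) (p : 'I_N -> T) (f : T -> R) (e : R) :
  measurable D -> measurable_fun D f -> (forall x, D x -> `|f x| <= 1) ->
  (forall i, measurable (A i)) -> trivIset setT A -> (forall i, A i `<=` D) ->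
  (forall i, D (p i)) -> (forall i x, A i x -> `|f x - f (p i)| <= e) ->
  (`|\int[mu]_(x in D) (f x)%:E - (\sum_(i < N) fine (mu (A i)) * f (p i))%:E| <=
   e%:E * mu (\big[setU/set0]_(i < N) A i) +
   mu (D `\` \big[setU/set0]_(i < N) A i))%E.
Proof.
move=> mD mf f1 mA tA AD Dp fp; set U := \big[setU/set0]_(i < N) A i.
have mU : measurable U by exact: bigsetU_measurable.
have UD : U `<=` D.
  by move=> x; rewrite /U -bigcup_seq => -[i _]; exact: AD.
have mfS S : S `<=` D -> measurable S -> measurable_fun S (EFin \o f).
  by move=> SD mS; apply/measurable_EFinP; exact: measurable_funS mf.
have fint S : S `<=` D -> measurable S -> mu.-integrable S (EFin \o f).
  move=> SD mS; apply: measurable_bounded_integrable => //.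
  - by rewrite ltey_eq fin_num_measure.
  - exact: measurable_funS mf.
  - exists 1; split=> // x x1 y Sy; apply: le_trans (ltW x1).
    exact: f1 (SD _ Sy).
have Sint S : S `<=` D -> measurable S ->
    (\int[mu]_(x in S) (f x)%:E)%E \is a fin_num.
  by move=> SD mS; exact: integrable_fin_num (fint S SD mS).
(* Used with c = f (p i) and b = e on a cell, and with c = 0 and b = 1 on what the cells miss. *)
have bnd S (c b : R) : S `<=` D -> measurable S ->
    (forall x, S x -> `|f x - c| <= b) ->
    `|fine (\int[mu]_(x in S) (f x)%:E)%E - c * fine (mu S)| <= b * fine (mu S).
  move=> SD mS fb.
  have muS : mu S \is a fin_num by exact: fin_num_measure.
  have E : (\int[mu]_(x in S) ((f x)%:E - (cst c x)%:E) =
      \int[mu]_(x in S) (f x)%:E - c%:E * mu S)%E.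
    rewrite (integralB mS (fint S SD mS) (finite_measure_integrable_cst mu c mS)).
    by rewrite (integral_cst mu mS c%:E).
  rewrite -lee_fin -abse_EFin !EFinB !EFinM !fineK ?Sint// -E.
  apply: le_trans (le_abse_integral _ mS _) _.
    by apply: emeasurable_funB; [exact: mfS|exact: (measurable_cst (c%:E))].
  rewrite -(integral_cst mu mS b%:E).
  apply: ge0_le_integral => //.
    apply: measurableT_comp => //.
    by apply: emeasurable_funB; [exact: mfS|exact: (measurable_cst (c%:E))].
have trU : trivIset [set` index_enum 'I_N] A by exact: sub_trivIset tA.
have US : (\int[mu]_(x in U) (f x)%:E = \sum_(i < N) \int[mu]_(x in A i) (f x)%:E)%E.
  apply: integral_bigsetU_EFin => //; first exact: index_enum_uniq.
  exact: mfS.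
have muU : (mu U = \sum_(i < N) mu (A i))%E.
  have := @ge0_integral_bigsetU _ _ _ mu _ A (cst 1%E) (index_enum 'I_N) mA
    (index_enum_uniq _) trU (measurable_cst _) (fun _ _ => lee01).
  rewrite integral_cst// mul1e => ->.
  by apply: eq_bigr => i _; rewrite integral_cst// mul1e.
have DE : (\int[mu]_(x in D) (f x)%:E =
    \int[mu]_(x in U) (f x)%:E + \int[mu]_(x in D `\` U) (f x)%:E)%E.
  rewrite -[in LHS](setDUK UD) integral_setU//; first exact: measurableD.
    by rewrite setDUK//; exact: mfS.
  by rewrite disj_set2E setDIK.
have mDU : measurable (D `\` U) by exact: measurableD.
have DUD : D `\` U `<=` D by exact: subDsetl.
rewrite DE US muU.
rewrite (eq_bigr (fun i => (fine (\int[mu]_(x in A i) (f x)%:E))%:E)%E); last first.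
  by move=> i _; rewrite fineK// Sint.
rewrite -(fineK (Sint _ DUD mDU)) -(fineK (fin_num_measure mu _ mDU)).
rewrite [X in (_ * X)%E](eq_bigr (fun i => (fine (mu (A i)))%:E)); last first.
  by move=> i _; rewrite fineK// fin_num_measure.
rewrite !sumEFin -EFinD abse_EFin -EFinM -EFinD lee_fin.
rewrite addrAC -sumrB (le_trans (ler_normD _ _))// lerD//.
  rewrite (le_trans (ler_norm_sum _ _ _))// mulr_sumr ler_sum// => i _.
  by rewrite mulrC; apply: bnd => // x; exact: fp.
have := bnd _ 0 1 DUD mDU; rewrite mul0r subr0 mul1r; apply => x [Dx _].
by rewrite subr0 f1.
Qed.
End discrete_measure.

(** * Quantization of varifolds *)

Section quantization.
Context (R : realType) (n d : nat).
Implicit Types (mu nu : varifold R n d) (p q : ambient R n d).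

Lemma borel_open (U : set (ambient R n d)) :
  open U -> measurable (U : set (borel R n d)).
Proof. exact: sub_sigma_algebra. Qed.

Lemma borel_closed (F : set (ambient R n d)) :
  closed F -> measurable (F : set (borel R n d)).
Proof.
move=> cF; rewrite -[F]setCK; apply: measurableC.
by apply: borel_open; exact: closed_openC.
Qed.

Lemma measurable_orpts : measurable (orpts R n d : set (borel R n d)).
Proof. exact: borel_closed (@closed_orpts R n d). Qed.

Lemma open_dist_ball p (e : R) : open [set q | dist p q < e].
Proof.
apply: (open_comp (f := dist p) (D := [set x | x < e])); last exact: open_lt.
by move=> q _; exact: continuous_dist.
Qed.

Lemma closed_dist_ball p (e : R) : closed [set q | dist p q <= e].
Proof.
apply: (preimage_closed (f := dist p) (D := [set x | x <= e])); last exact: closed_le.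
by move=> q _; exact: continuous_dist.
Qed.

(** By the Lipschitz bound, if w p > a then w > a at every point of [orpts] closer to p than w p -
    a. Superlevel sets are therefore traces on [orpts] of unions of open balls, whatever [w] does
    elsewhere. *)
Lemma measurable_test_function (w : ambient R n d -> R) :
  test_function w -> measurable_fun (orpts R n d : set (borel R n d)) w.
Proof.
move=> [_ wlip] mD.
apply: (measurability _ (RGenOInfty.measurableE R) _ mD).
move=> /= _ [_ [a ->] <-].
have -> : orpts R n d `&` w @^-1` `]a, +oo[%classic =
    orpts R n d `&` \bigcup_(p in [set p | orpts R n d p /\ a < w p])
      [set q | dist p q < w p - a].
  apply/seteqP; split => [q [oq]|q [oq [p [op ap] /= pq]]].
    rewrite /= in_itv/= andbT => aq; split=> //; exists q => //=.
    by rewrite distxx subr_gt0.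
  split=> //=; rewrite in_itv/= andbT.
  by have := wlip _ _ op oq; rewrite ler_norml => /andP[_]; lra.
apply: measurableI; first exact: measurable_orpts.
apply: borel_open; apply: bigcup_open => p _; exact: open_dist_ball.
Qed.

(** The mass of [E] travels at most [e] to a point of the net; the mass outside [E] is discarded. *)
Lemma quantization mu (N : nat) (q : 'I_N -> ambient R n d)
    (E : set (borel R n d)) (e : R) :
  measurable E -> E `<=` orpts R n d -> (forall i, orpts R n d (q i)) ->
  (forall p, E p -> exists i, dist p (q i) <= e) ->
  exists nu, (exists r : 'I_N -> R, (forall i, 0 <= r i) /\
      forall A : set (borel R n d),
        nu A = (\sum_(i < N) (r i)%:E * \d_(q i : borel R n d) A)%E) /\
    (dBL nu mu <= e%:E * mu E + mu (orpts R n d `\` E))%E.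
Proof.
move=> mE Eor qor Eq.
pose F k : set (borel R n d) :=
  if insub k is Some i then E `&` [set p | dist (q i) p <= e] else set0.
have FE (i : 'I_N) : F i = E `&` [set p | dist (q i) p <= e].
  by rewrite /F valK.
have mF k : measurable (F k).
  rewrite /F; case: insubP => // i _ _; apply: measurableI => //.
  by apply: borel_closed; exact: closed_dist_ball.
(* Points in several balls go to the ball of least index, so that no mass is moved twice. *)
pose A (i : 'I_N) := seqDU F i.
have mA i : measurable (A i) by exact: seqDU_measurable.
have AF i : A i `<=` F i by exact: subDsetl.
have tA : trivIset setT A.
  by move=> i j _ _ /(@trivIset_seqDU _ F i j I I)/val_inj.
have UA : \big[setU/set0]_(i < N) A i = E.
  rewrite -bigcup_seq; apply/seteqP; split => [p [i _ /AF]|p Ep].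
    by rewrite FE => -[].
  have [i pi] := Eq _ Ep.
  have : (\bigcup_k F k) p by exists i => //; rewrite FE; split; rewrite //= dist_sym.
  rewrite seqDU_bigcup_eq => -[k _ kp].
  have : F k p by case: kp.
  rewrite /F; case: insubP => // j _ jk _; exists j; first exact: mem_index_enum.
  by rewrite /A jk.
have r0 i : 0 <= fine (mu (A i)) by rewrite fine_ge0.
have [nu [nuE nuint]] := sum_dirac_measure (fun i => (q i : borel R n d)) r0.
have nu_off : nu (~` orpts R n d) = 0%E.
  rewrite nuE big1// => i _; rewrite diracE memNset ?mule0//.
  by move=> /(_ (qor i)).
exists (Varifold nu_off); split; first by exists (fun i => fine (mu (A i))).
apply: ge_ereal_sup => _ [w wt <-].
have mw := measurable_test_function wt.
case: wt => w1 wlip.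
rewrite /pairing nuint//; last exact: measurable_orpts.
have absB (a : R) (x : \bar R) : (`|a%:E - x| = `|x - a%:E|)%E.
  by case: x => [r| |] //=; rewrite distrC.
rewrite absB.
have := @integral_step_le _ _ R mu N (orpts R n d) A q w e measurable_orpts mw
  w1 mA tA _ qor.
rewrite UA; apply=> [i p /AF|i p /AF]; rewrite FE => -[Ep]; first by move=> _; exact: Eor.
by rewrite /= dist_sym; apply: le_trans; apply: wlip; [exact: Eor|exact: qor].
Qed.

End quantization.

(** * Approximation along nets *)

Section approximation.
Context (R : realType) (n d : nat).
Implicit Types (mu nu : varifold R n d) (p q : ambient R n d).

(** The triangle inequality is taken coordinate by coordinate, at the price of a constant. This is
    enough to fit small balls into an open set. *)
Lemma dist_quasi_triangle p q s :
  dist p s <= (n + #|increasing n d|)%:R * (dist p q + dist q s).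
Proof.
apply: le_trans (dist_le_sum _ _) _; rewrite natrD mulrDl.
apply: lerD; rewrite mulr_natl -[X in _ *+ X]card_ord -sumr_const;
  apply: ler_sum => i _; apply: le_trans (ler_distD _ _ _) _.
  exact: lerD (dist_ge_coord1 p q i) (dist_ge_coord1 q s i).
exact: lerD (dist_ge_coord2 p q i) (dist_ge_coord2 q s i).
Qed.

Lemma coord_le_norm p i : `|p.1 ord0 i| <= `|p|.
Proof.
rewrite prod_normE le_max; apply/orP; left.
rewrite [leRHS]mx_normrE; exact: (le_bigmax _ (fun i => `|p.1 i.1 i.2|) (ord0, i)).
Qed.

Lemma closed_norm_ball (r : R) : closed [set p : ambient R n d | `|p| <= r].
Proof.
apply: (preimage_closed (f := fun p : ambient R n d => `|p|)
  (D := [set x | x <= r])); last exact: closed_le.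
by move=> p _; exact: norm_continuous.
Qed.

Lemma vsupport_discrete nu N (r : 'I_N -> R) (q : 'I_N -> ambient R n d)
    (K : set (ambient R n d)) :
  (forall A : set (borel R n d),
    nu A = (\sum_(i < N) (r i)%:E * \d_(q i : borel R n d) A)%E) ->
  closed K -> (forall i, K (q i)) -> vsupport nu `<=` K.
Proof.
move=> nuE cK Kq p sp; apply: contrapT => nKp.
have := sp (~` K) (closed_openC cK) nKp.
rewrite nuE big1 ?ltxx// => i _.
by rewrite diracE memNset ?mule0// => /(_ (Kq i)).
Qed.

Lemma vsupport_sub_orpts mu : vsupport mu `<=` orpts R n d.
Proof.
move=> p sp; apply: contrapT => nop.
have := sp (~` orpts R n d) (closed_openC (@closed_orpts R n d)) nop.
by rewrite varifold_off ltxx.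
Qed.

Lemma net_approximation mu (S : set (ambient R n d)) p0 (r : R) (k N : nat) :
  S `<=` orpts R n d -> measurable (S : set (borel R n d)) -> orpts R n d p0 ->
  1 <= r -> (forall p i, S p -> `|p.1 ord0 i| <= r) -> (0 < k)%N ->
  (net_card n d * k ^ (n + d * (n - d)) <= N)%N ->
  exists nu, [/\ discrete_varifold N nu,
    forall K, closed K -> S `<=` K -> K p0 -> vsupport nu `<=` K &
    (dBL nu mu <= ((net_lip n d)%:R * r / k%:R)%:E * mu S +
                  mu (orpts R n d `\` S))%E].
Proof.
move=> Sor mS op0 r1 Sr k0 kN.
have [q [qS Sq]] := orpts_net p0 Sor r1 Sr k0 kN.
have qor i : orpts R n d (q i) by case: (qS i) => [/Sor|->].
have [nu [[w [w0 nuE]] nud]] := quantization mu mS Sor qor Sq.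
exists nu; split=> //; first by exists w, q; split.
move=> K cK SK Kp0; apply: vsupport_discrete nuE cK _ => i.
by case: (qS i) => [/SK|->].
Qed.

(** Quantization with [E] empty: every atom gets weight 0. It covers the N that are too small for
    any net. *)
Lemma trivial_approximation mu p0 N : orpts R n d p0 ->
  exists nu, [/\ discrete_varifold N nu,
    forall K, closed K -> K p0 -> vsupport nu `<=` K &
    (dBL nu mu <= mu (orpts R n d))%E].
Proof.
move=> op0.
have [nu [[w [w0 nuE]] nud]] := @quantization _ _ _ mu N (fun=> p0) set0 0
  measurable0 (sub0set _) (fun=> op0) (fun _ f => False_ind _ f).
exists nu; split=> //; first by exists w, (fun=> p0); split.
  by move=> K cK Kp0; exact: vsupport_discrete nuE cK _.
by rewrite mul0e add0e setD0 in nud.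
Qed.

Lemma archi (x : R) : exists j : nat, x < j.+1%:R.
Proof.
have [x0|x0] := leP 0 x; last by exists 0%N; apply: lt_trans x0 _.
by exists (Num.truncn x); have /andP[] := truncn_itv x0.
Qed.

(* Balls of radius L / (j + 1) around the nets form a countable family that
   refines every open cover, which replaces second countability. *)
Lemma vsupport_conull mu : closed (vsupport mu) ->
  mu (orpts R n d `\` vsupport mu) = 0%E.
Proof.
move=> cS; pose S := vsupport mu.
pose E j := orpts R n d `&` [set p | `|p| <= j.+1%:R].
(* Radius j + 1 and k = (j + 1)^2 give a net of scale [e j]. *)
pose N j := (net_card n d * (j.+1 ^ 2) ^ (n + d * (n - d)))%N.
pose e j : R := (net_lip n d)%:R / j.+1%:R.
have netj j : exists q : 'I_(N j) -> ambient R n d,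
    forall p, E j p -> exists i, dist p (q i) <= e j.
  have [|||||q [_ qE]] := @orpts_net R n d (E j) 0 j.+1%:R (j.+1 ^ 2) (N j) => //.
  - by move=> p [].
  - by rewrite ler1n.
  - by move=> p i [_ /= pj]; apply: le_trans pj; exact: coord_le_norm.
  exists q => p /qE[i pi]; exists i; apply: le_trans pi _.
  by rewrite natrX expr2 invfM mulrA mulfK// pnatr_eq0.
(* [M] is the union of the null balls of the j-th net. The ball that covers [p] is one of them as
   soon as it lies in a null open set. *)
have nullj j : exists M : set (borel R n d), mu.-negligible M /\
    forall p, E j p -> (exists U, [/\ open U, mu U = 0%E &
      forall c s, dist c p <= e j -> dist c s <= e j -> U s]) -> M p.
  have [q qE] := netj j.
  pose B i : set (borel R n d) := [set s | dist (q i) s <= e j].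
  have mB i : measurable (B i) by apply: borel_closed; exact: closed_dist_ball.
  exists (\big[setU/set0]_(i < N j | mu (B i) == 0%E) B i); split.
    apply: (big_ind (fun A => mu.-negligible A)).
    - exact: negligible_set0.
    - by move=> A A' ? ?; exact: negligibleU.
    - by move=> i /eqP Bi0; exact/negligibleP.
  move=> p Ep [U [oU U0 pU]]; have [i pi] := qE _ Ep.
  rewrite -bigcup_seq_cond; exists i; last by rewrite /B /= dist_sym.
  rewrite /= mem_index_enum /=; apply/eqP.
  apply: (subset_measure0 (mB i) (borel_open oU) _ U0) => s Bs.
  by apply: pU Bs; rewrite dist_sym.
have [M MP] := choice nullj.
have Mneg : mu.-negligible (\bigcup_j M j).
  by apply: negligible_bigcup => j; exact: (MP j).1.
apply: measure_negligible.
  by apply: measurableD; [exact: measurable_orpts|exact: borel_closed].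
apply: negligibleS Mneg => p [op nSp].
have [U [oU [Up U0]]] : exists U, open U /\ U p /\ mu U = 0%E.
  apply: contrapT => nU; apply: nSp => U oU Up; rewrite lt0e measure_ge0 andbT.
  by apply/eqP => U0; apply: nU; exists U.
have [a a0 aU] := nbhs_dist oU Up.
(* Large enough that [E j] contains [p], and that two steps of length [e j] from [p], by the
   quasi-triangle inequality, stay within [a]. *)
have [j jp] := archi (Num.max `|p|
  ((n + #|increasing n d|)%:R * (2 * (net_lip n d)%:R) / a)).
exists j => //; apply: (MP j).2.
  by split=> //=; apply/ltW/(le_lt_trans _ jp); rewrite le_max lexx.
exists U; split=> // c s cp cs; apply: aU.
apply: le_lt_trans (dist_quasi_triangle p c s) _.
have : (n + #|increasing n d|)%:R * (2 * (net_lip n d)%:R) / a < j.+1%:R :> R.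
  by apply: le_lt_trans jp; rewrite le_max lexx orbT.
rewrite ltr_pdivrMr// => lt_a.
have ej : e j * j.+1%:R = (net_lip n d)%:R by rewrite /e divfK// pnatr_eq0.
have j0 : 0 < j.+1%:R :> R by rewrite ltr0n.
rewrite -(ltr_pM2r j0) [ltRHS]mulrC; apply: le_lt_trans lt_a.
rewrite -mulrA ler_wpM2l// -ej mulrA ler_wpM2r//.
have : dist p c <= e j by rewrite dist_sym.
by move=> pc; rewrite mulr_natl mulr2n; exact: lerD.
Qed.
End approximation.

(** It selects the finest net that N atoms can afford; positivity of [b] and [D] bounds the
    candidates [k] by N. *)
Lemma expn_floor (b D N : nat) : (0 < b)%N -> (0 < D)%N ->
  exists k, (b * k ^ D <= N < b * k.+1 ^ D)%N.
Proof.
move=> b0 D0; have ex : exists k, (b * k ^ D <= N)%N by exists 0%N; rewrite exp0n ?muln0.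
have bd k : (b * k ^ D <= N)%N -> (k <= N)%N.
  case: k => // k; apply: leq_trans; rewrite -[leqLHS]expn1.
  by rewrite (leq_trans (leq_pexp2l _ D0))// leq_pmull.
case: (ex_maxnP ex bd) => k kN kmax; exists k; rewrite kN ltnNge; apply/negP.
by move=> /kmax; rewrite ltnn.
Qed.

(** Take for [j_ N] the largest j <= N with [P N j]. The cap N makes the maximum exist, and [P N 0]
    makes it attained. *)
Lemma diagonal (P : nat -> nat -> Prop) : (forall N, P N 0%N) ->
  (forall j, exists N0, forall N, (N0 <= N)%N -> P N j) ->
  exists j_ : nat -> nat, (forall N, P N (j_ N)) /\ j_ N @[N --> \oo] --> \oo.
Proof.
move=> P0 Pj; pose j_ N := \max_(j < N.+1 | `[< P N j >]) (j : nat).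
exists j_; split.
  move=> N; have [|i Pi iE] := @eq_bigmax_cond _
    (fun j : 'I_N.+1 => `[< P N j >]) (fun j => val j).
    by apply/card_gt0P; exists ord0; rewrite unfold_in; apply/asboolP/P0.
  have -> : j_ N = i by exact: iE.
  by move: Pi; rewrite unfold_in => /asboolP.
apply/cvgnyPge => j; have [N0 PN0] := Pj j.
exists (maxn N0 j) => // N; rewrite /= geq_max => /andP[NN0 Nj].
have jN : (j < N.+1)%N by rewrite ltnS.
apply: (@leq_bigmax_cond _ _ (fun j : 'I_N.+1 => val j) (Ordinal jN)).
exact/asboolP/PN0.
Qed.

(** * Limits and rates *)

Lemma dBL_ge0 (R : realType) n d (mu nu : varifold R n d) : (0 <= dBL mu nu)%E.
Proof.
apply: (@le_trans _ _ `|pairing mu (fun=> 0%R) - pairing nu (fun=> 0%R)|%E) => //.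
apply: ereal_sup_ubound; exists (fun=> 0) => //.
by split=> [p _|p q _ _]; rewrite ?subr0 normr0 ?ler01 ?dist_ge0.
Qed.

Lemma discrete_varifolds_dense (R : realType) n d (mu : varifold R n d) :
  (d <= n)%N -> exists mu_ : nat -> varifold R n d,
    (forall N, discrete_varifold N (mu_ N)) /\ dBL (mu_ N) mu @[N --> \oo] --> 0%E.
Proof.
move=> dn; have [p0 op0] := @orpts_nonempty R n d dn.
pose E j : set (borel R n d) :=
  orpts R n d `&` [set p : ambient R n d | `|p| <= j.+1%:R].
have mE j : measurable (E j).
  apply: measurableI; first exact: measurable_orpts.
  by apply: borel_closed; exact: closed_norm_ball.
(* Index 0 is the zero varifold, available for every N. At index j' + 1 the scale is a multiple of
   [harmonic j'], left by radius j' + 1 and k = (j' + 1)^2. *)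
pose err j := if j is j'.+1 then
  (((net_lip n d)%:R * fine (mu setT) * harmonic j')%:E +
   mu (orpts R n d `\` E j'))%E
  else mu (orpts R n d).
pose P N j := exists nu, discrete_varifold N nu /\ (dBL nu mu <= err j)%E.
have P0 N : P N 0%N.
  by have [nu [nuN _ nud]] := trivial_approximation mu N op0; exists nu.
have Pj j : exists N0, forall N, (N0 <= N)%N -> P N j.
  case: j => [|j]; first by exists 0%N.
  exists (net_card n d * (j.+1 ^ 2) ^ (n + d * (n - d)))%N => N jN.
  have [|||||||nu [nuN _ nud]] :=
    @net_approximation R n d mu (E j) p0 j.+1%:R (j.+1 ^ 2)%N N => //.
  - by move=> p [].
  - by rewrite ler1n.
  - by move=> p i [_ /= pj]; apply: le_trans pj; exact: coord_le_norm.
  exists nu; split=> //; apply: le_trans nud _.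
  rewrite /= leeD2r// natrX expr2 invfM mulrA mulfK ?pnatr_eq0//.
  have -> : ((net_lip n d)%:R * fine (mu setT) * harmonic j)%:E =
      (((net_lip n d)%:R / j.+1%:R)%:E * mu setT)%E.
    by rewrite mulrAC EFinM fineK ?fin_num_measure//.
  by rewrite lee_wpmul2l ?lee_fin ?divr_ge0// le_measure ?inE.
have [j_ [Pj_ joo]] := diagonal P0 Pj.
have [mu_ mu_P] := choice Pj_.
exists mu_; split=> [N|]; first exact: (mu_P N).1.
apply: (@squeeze_cvge _ _ _ _ (fun=> 0%E) _ (fun N => err (j_ N))).
- by apply: nearW => N; rewrite dBL_ge0; exact: (mu_P N).2.
- exact: cvg_cst.
apply: (cvg_comp _ _ joo).
have err1 : ((net_lip n d)%:R * fine (mu setT) * harmonic j)%:E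
    @[j --> \oo] --> (0%E : \bar R).
  apply: cvg_EFin; first exact: nearW.
  rewrite -[X in _ --> X](mulr0 ((net_lip n d)%:R * fine (mu setT))).
  by apply: cvgMr; exact: cvg_harmonic.
(* The sets [E j] exhaust [orpts], and a finite measure is continuous from above. *)
suff err2 : mu (orpts R n d `\` E j) @[j --> \oo] --> (0%E : \bar R).
  have : err j.+1 @[j --> \oo] --> (0%E : \bar R).
    by have := cvgeD _ err1 err2; rewrite adde0 => /(_ _ isT).
  by rewrite (cvg_shiftS err).
have cap0 : \bigcap_j (orpts R n d `\` E j) = set0.
  rewrite -subset0 => p pE; have [j jp] := archi `|p|.
  by have [op] := pE j I; apply; split=> //; exact: ltW.
have mD j : measurable (orpts R n d `\` E j : set (borel R n d)).
  by apply: measurableD => //; exact: measurable_orpts.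
rewrite -(measure0 mu) -cap0; apply: nonincreasing_cvg_mu => //.
- by rewrite ltey_eq fin_num_measure.
- by rewrite cap0; exact: measurable0.
- move=> i j ij; apply/subsetPset => p [op npj]; split=> // -[_ /= pi].
  by apply: npj; split=> //=; apply: le_trans pi _; rewrite ler_nat.
Qed.

(** As b <= b ^ D, N is below the D-th power of b (k + 1). Keeping [b] in place of its D-th root
    only affects the constant. *)
Lemma root_le (R : realType) (b D k N : nat) : (0 < b)%N -> (0 < D)%N ->
  (N < b * k.+1 ^ D)%N -> (N%:R : R) `^ (1 / D%:R) <= (b * k.+1)%:R.
Proof.
move=> b0 D0 Nk.
have D0' : D%:R != 0 :> R by rewrite pnatr_eq0 -lt0n.
have -> : (b * k.+1)%:R = ((b * k.+1)%:R `^ D%:R) `^ (1 / D%:R) :> R.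
  by rewrite -powRrM mul1r divff// powRr1.
apply: ge0_ler_powR; rewrite ?nnegrE ?powR_ge0//.
rewrite powR_mulrn// -natrX ler_nat (leq_trans (ltnW Nk))// expnMn leq_mul//.
by rewrite -[leqLHS]expn1 leq_pexp2l.
Qed.

Lemma cvg_inv_root (R : realType) (D : nat) (c : R) : (0 < D)%N ->
  (c / (N%:R `^ (1 / D%:R)))%:E @[N --> \oo] --> (0%:E : \bar R).
Proof.
move=> D0; apply: cvg_EFin; first exact: nearW.
rewrite -[X in _ --> X](mulr0 c); apply: cvgMr.
have N0 : \forall N \near \oo, 0 < (N%:R : R) `^ (1 / D%:R).
  by exists 1%N => // N /= N0; apply: powR_gt0; rewrite ltr0n.
apply/(gtr0_cvgV0 N0)/cvgryPge => A; have [j jA] := archi A.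
exists (j.+1 ^ D)%N => // N /= jN; apply: (le_trans (ltW jA)).
have -> : j.+1%:R = (j.+1%:R `^ D%:R) `^ (1 / D%:R) :> R.
  by rewrite -powRrM mul1r divff ?powRr1// pnatr_eq0 -lt0n.
apply: ge0_ler_powR; rewrite ?nnegrE ?powR_ge0 ?divr_ge0//.
by rewrite powR_mulrn// -natrX ler_nat.
Qed.

Lemma compact_closed_ambient (R : realType) n d (K : set (ambient R n d)) :
  compact K -> closed K.
Proof.
by apply: compact_closed; exact: (@norm_hausdorff R (ambient R n d)).
Qed.

(** In the factor 1 + 2 L, the 1 serves k = 0, where N^(1/D) <= b, and 2 L serves k > 0, where k + 1
    <= 2 k. *)
Lemma rate_step (R : realType) (b D k N : nat) (L M e : R) :
  (0 < b)%N -> (0 < D)%N -> (0 < N)%N -> (N < b * k.+1 ^ D)%N -> 0 <= M -> 0 <= L ->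
  (if k is 0%N then e <= M else e <= L / k%:R * M) ->
  e <= M * b%:R * (1 + 2 * L) / (N%:R `^ (1 / D%:R)).
Proof.
move=> b0 D0 N0 Nk M0 L0 eM.
have t0 : 0 < (N%:R : R) `^ (1 / D%:R) by apply: powR_gt0; rewrite ltr0n.
have := @root_le R b D k N b0 D0 Nk; move: (_ `^ _) t0 => t t0.
rewrite natrM => tk; rewrite ler_pdivlMr//.
have bR : 0 < b%:R :> R by rewrite ltr0n.
have Mb : 0 <= M * b%:R by rewrite mulr_ge0// ltW.
case: k eM tk {Nk} => [|k] eM tk.
  rewrite mulr1 in tk.
  apply: (@le_trans _ _ (M * b%:R)).
    by apply: (@le_trans _ _ (M * t)); [rewrite ler_wpM2r// ltW|rewrite ler_wpM2l].
  by rewrite ler_peMr// lerDl mulr_ge0.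
have k0 : 0 < k.+1%:R :> R by rewrite ltr0n.
apply: (@le_trans _ _ (L / k.+1%:R * M * (b%:R * (2 * k.+1%:R)))).
  apply: (@le_trans _ _ (L / k.+1%:R * M * t)); first by rewrite ler_wpM2r// ltW.
  rewrite ler_wpM2l//; first by rewrite !mulr_ge0// invr_ge0 ltW.
  rewrite (le_trans tk)// ler_wpM2l//.
  by rewrite -natrM ler_nat mul2n -addnn addnS ltnS leq_addr.
have -> : L / k.+1%:R * M * (b%:R * (2 * k.+1%:R)) = M * b%:R * (2 * L).
  by field; rewrite gt_eqF.
by rewrite ler_wpM2l// lerDr ler01.
Qed.

Lemma net_card_gt0 n d : (d <= n)%N -> (0 < net_card n d)%N.
Proof.
rewrite /net_card !muln_gt0 !expn_gt0; case: n => [|n] //=.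
by rewrite leqn0 => ->.
Qed.

Lemma compact_support_approximation (R : realType) n d (S : set (ambient R n d))
    (r M : R) (mu : varifold R n d) p0 :
  (d <= n)%N -> compact S -> vsupport mu = S -> weight mu setT = M%:E ->
  orpts R n d p0 -> 1 <= r -> (forall p i, S p -> `|p.1 ord0 i| <= r) ->
  forall N, exists nu, [/\ discrete_varifold N nu,
    vsupport nu `<=` S `|` [set p0] &
    (0 < N)%N -> (dBL nu mu <= (M * (net_card n d)%:R *
      (1 + 2 * ((net_lip n d)%:R * r)) /
        (N%:R `^ (1 / (maxn (n + d * (n - d)) 1)%:R)))%:E)%E].
Proof.
(* The exponent n + d(n-d) vanishes when n = 0; the maximum keeps [D] positive, as the choice of [k]
   and the D-th root require. *)
move=> dn cS muS muM op0 r1 Sr N; set D := maxn _ 1.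
have D0 : (0 < D)%N by rewrite leq_max orbT.
have b0 := net_card_gt0 dn.
have {}cS : closed S by exact: compact_closed_ambient.
have cK : closed (S `|` [set p0]).
  by apply: closedU => //; apply: compact_closed_ambient; apply: finite_compact.
have Kp0 : (S `|` [set p0]) p0 by right.
have M0 : 0 <= M by rewrite -lee_fin -muM measure_ge0.
have L0 : 0 <= (net_lip n d)%:R * r by rewrite mulr_ge0// (le_trans _ r1).
have [k /andP[kN Nk]] := expn_floor N b0 D0.
have bound nu (e : R) : (0 < N)%N -> (dBL nu mu <= e%:E)%E ->
    (if k is 0%N then e <= M else e <= (net_lip n d)%:R * r / k%:R * M) ->
    (dBL nu mu <= (M * (net_card n d)%:R *
      (1 + 2 * ((net_lip n d)%:R * r)) / (N%:R `^ (1 / D%:R)))%:E)%E.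
  move=> N0 /le_trans nue ek; apply: nue; rewrite lee_fin.
  exact: rate_step b0 D0 N0 Nk M0 L0 ek.
have [k0|k0] := posnP k.
  have [nu [nuN nuK nud]] := trivial_approximation mu N op0.
  exists nu; split=> // [|N0]; first exact: nuK.
  by apply: (bound _ M) => //; [rewrite -muM|rewrite k0].
have Sor : S `<=` orpts R n d by rewrite -muS; exact: vsupport_sub_orpts.
have mS : measurable (S : set (borel R n d)) by exact: borel_closed.
have kN' : (net_card n d * k ^ (n + d * (n - d)) <= N)%N.
  by rewrite (leq_trans _ kN)// leq_mul2l leq_pexp2l ?orbT// leq_maxl.
have [nu [nuN nuK nud]] := net_approximation mu Sor mS op0 r1 Sr k0 kN'.
exists nu; split=> // [|N0]; first by apply: nuK => // p Sp; left.
apply: (bound _ ((net_lip n d)%:R * r / k%:R * M)) => //; last by case: (k) k0.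
apply: le_trans nud _.
(* The complement of the support is null, so only the transport term remains. *)
have := @vsupport_conull R n d mu; rewrite muS => /(_ cS) ->.
rewrite adde0 [leRHS]EFinM; apply: lee_wpmul2l; first by rewrite lee_fin divr_ge0.
by rewrite -muM; apply: le_measure; rewrite ?inE//; exact: measurable_orpts.
Qed.

Theorem theorem5p1 (R : realType) (n d : nat) (hdn : (d <= n)%N) :
  (forall mu : varifold R n d, (weight mu setT < +oo)%E ->
     exists mu_ : nat -> varifold R n d,
       (forall N, (1 <= N)%N -> discrete_varifold N (mu_ N)) /\
       dBL (mu_ N) mu @[N --> \oo] --> 0%E) /\
  (forall (S : set (ambient R n d)) (M : R),
     compact S ->
     exists C : R,
       forall mu : varifold R n d,
         vsupport mu = S -> weight mu setT = M%:E ->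
         exists mu_ : nat -> varifold R n d,
           [/\ forall N, (1 <= N)%N -> discrete_varifold N (mu_ N),
               dBL (mu_ N) mu @[N --> \oo] --> 0%E,
               exists K : set (ambient R n d),
                 [/\ compact K, K `<=` orpts R n d &
                     forall N, (1 <= N)%N -> vsupport (mu_ N) `<=` K] &
               forall N, (1 <= N)%N ->
                 (dBL (mu_ N) mu <
                    (C / N%:R `^ (1 / (n + d * (n - d))%:R))%:E)%E]).
Proof.
split=> [mu _|S M cS].
  have [mu_ [muN muc]] := discrete_varifolds_dense mu hdn.
  by exists mu_; split.
have [p0 op0] := @orpts_nonempty R n d hdn.
have [r r1 Sr] : exists2 r : R, 1 <= r & forall p i, S p -> `|p.1 ord0 i| <= r.
  have [b [_ bS]] : bounded_set S by exact: compact_bounded.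
  exists (Num.max 1 (b + 1)); first by rewrite le_max lexx.
  move=> p i Sp; apply: le_trans (coord_le_norm p i) _.
  by apply: bS => //; rewrite lt_max ltrDl ltr01 orbT.
pose C := M * (net_card n d)%:R * (1 + 2 * ((net_lip n d)%:R * r)).
(* The added 1 makes the inequality strict, even for mass 0. *)
exists (C + 1) => mu muS muM.
have M0 : 0 <= M by rewrite -lee_fin -muM measure_ge0.
have C0 : 0 <= C.
  by rewrite !mulr_ge0// addr_ge0// !mulr_ge0// (le_trans _ r1).
have [mu_ mu_P] := choice (compact_support_approximation hdn cS muS muM op0 r1 Sr).
exists mu_; split.
- by move=> N _; case: (mu_P N).
(* The bound with exponent at least 1 in the root is used here: for n = 0 the rate in the statement
   is constant and would not give convergence. *)
- apply: (@squeeze_cvge _ _ _ _ (fun=> 0%E) _ (fun N =>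
    (C / (N%:R `^ (1 / (maxn (n + d * (n - d)) 1)%:R)))%:E)).
  + exists 1%N => // N /= N0; rewrite dBL_ge0/=; case: (mu_P N) => _ _; exact.
  + exact: cvg_cst.
  + by apply: cvg_inv_root; rewrite leq_max orbT.
- exists (S `|` [set p0]); split.
  + apply: compact_setU => //; exact: finite_compact.
  + by move=> p [|->//]; rewrite -muS; exact: vsupport_sub_orpts.
  + by move=> N _; case: (mu_P N).
move=> N N0; case: (mu_P N) => _ _ /(_ N0) /le_lt_trans; apply.
rewrite lte_fin -/C.
have NR : 1 <= N%:R :> R by rewrite ler1n.
have t0 (a : R) : 0 < (N%:R : R) `^ a by rewrite powR_gt0// (lt_le_trans _ NR).
apply: (@le_lt_trans _ _ (C / N%:R `^ (1 / (n + d * (n - d))%:R))).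
  rewrite ler_wpM2l// lef_pV2 ?posrE//.
  (* For n = 0, 1 / 0 is 0 and the power of N in the statement is 1, which is at most the N of the
     stronger bound. *)
  have [->|D0] := posnP (n + d * (n - d)); last by rewrite (maxn_idPl D0).
  by rewrite invr0 mulr0 powRr0 max0n divr1 powRr1// ler0n.
by rewrite ltr_pM2r ?invr_gt0// ltrDl ltr01.
Qed.
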